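(* Consider the Delivery Man Problem on a tree network $Q$ with $n\ge 2$ nodes, all of whose $n-1$ arcs have unit length. Then (i) for depot (root) a node $O$, the optimal expected search time is $$V(e)=n-1-\bar d_e(O),$$ where $\bar d_e(O)$ is the mean distance from $O$ to all nodes of the network (including $O$); (ii) the optimal choice of depot (that is, of the node $O$ at which the search starts, so as to minimize $V(e)$) is the leaf node $x$ of minimum closeness centrality.
   Context: $Q$ is a tree network with unit length arcs, regarded as a metric space with path-length metric $d$; points of $Q$ may be nodes or interior points of arcs. The equiprobable distribution $e$ is the atomic probability measure placing equal weight on each node of $Q$ (including the root node). The Delivery Man Problem is the problem of finding an optimal search against $e$. A search with root (depot) $O$ is a function $S:[0,\infty)\to Q$ with $S(0)=O$ and $d(S(t_1),S(t_2))\le t_2-t_1$ for $0\le t_1<t_2$. Put $T(S,x)=\min\{t\ge 0:S(t)=x\}$ (or $+\infty$) and $T(S,e)=\int_Q T(S,x)\,de(x)$, i.e. the average over nodes of the first time they are reached. $V(e)=\min_S T(S,e)$ is the optimal expected search time (it depends on $O$). The closeness centrality of a node $x$ is the reciprocal of the mean distance from $x$ to all other nodes. A leaf node here is a node of degree 1. *)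

(* Defs.v *)
From HB Require Import structures.
From mathcomp Require Import all_boot all_order all_algebra.
From mathcomp Require Import all_classical all_reals all_analysis.
Set Implicit Arguments.
Unset Strict Implicit.
Unset Printing Implicit Defensive.
Import Order.TTheory GRing.Theory Num.Theory.
Local Open Scope classical_set_scope.
Local Open Scope ring_scope.

Definition is_tree (T : finType) (adj : rel T) : Prop :=
  [/\ symmetric adj, irreflexive adj,
      (forall u v, connect adj u v)
    & (forall c : seq T, (2 < size c)%N -> ~ ucycle adj c)].

Definition is_leaf (T : finType) (adj : rel T) (x : T) : bool :=
  #|[set y | adj x y]%SET| == 1%N.

Section Network.
Variables (R : realType) (T : finType) (adj : rel T).

Definition supported_on (u v : T) (p : {ffun T -> R}) : bool :=
  [forall w, (p w != 0) ==> (w == u) || (w == v)].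

(* The network is the geometric realization of the graph: a point is given by
   its barycentric coordinates, so a node has a single coordinate equal to 1,
   and the point of the arc uv at distance s from u has coordinates 1 - s at u
   and s at v. Every point thus has exactly one representation. *)
Definition on_network (p : {ffun T -> R}) : bool :=
  [&& [forall v, 0 <= p v], \sum_v p v == 1 &
      [exists u, exists v, ((u == v) || adj u v) && supported_on u v p]].

Definition network : Type := {p : {ffun T -> R} | on_network p}.

Definition coord (p : network) : {ffun T -> R} := sval p.

Definition node_coord (v : T) : {ffun T -> R} := [ffun w => (w == v)%:R].

Lemma node_on_network (v : T) : on_network (node_coord v).
Proof.
apply/and3P; split.
- by apply/forallP => w; rewrite ffunE ler0n.
- rewrite (bigD1 v) //= big1 ?addr0 ?ffunE ?eqxx //.
  by move=> w /negPf wv; rewrite ffunE wv.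
- apply/existsP; exists v; apply/existsP; exists v; rewrite eqxx /=.
  by apply/forallP => w; apply/implyP; rewrite ffunE; case: (w == v);
    rewrite ?eqxx.
Qed.

Definition node (v : T) : network := exist _ (node_coord v) (node_on_network v).

(* Lengths of the routes from p to q: either straight along an arc containing
   both points, or from p to an end u of its arc (u = p if p is a node), along
   unit arcs through the nodes u :: s, and from the last of these to q. *)
Definition route_length (p q : network) : set R :=
  [set l | (exists u v, [/\ adj u v, supported_on u v (coord p),
                            supported_on u v (coord q)
                          & l = `|coord p u - coord q u|])
        \/ (exists u s, [/\ 0 < coord p u, path adj u s,
                            0 < coord q (last u s)
                          & l = (1 - coord p u) + (size s)%:R
                                + (1 - coord q (last u s))])].

Definition dist (p q : network) : R := inf (route_length p q).

(* A search is a function on [0, +oo[; its values at negative times are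
   irrelevant. *)
Definition is_search (O : T) (S : R -> network) : Prop :=
  S 0 = node O /\
  forall t1 t2, 0 <= t1 -> t1 < t2 -> dist (S t1) (S t2) <= t2 - t1.

(* For a search, which is continuous, the infimum is a minimum if x is ever
   reached, and it is +oo otherwise. *)
Definition first_time (S : R -> network) (x : network) : \bar R :=
  ereal_inf [set t%:E | t in [set t | 0 <= t /\ S t = x]].

Definition equiprob (v : T) : R := #|T|%:R^-1.

Definition expected_time (S : R -> network) : \bar R :=
  (\sum_(v : T) (equiprob v)%:E * first_time S (node v))%E.

Definition value (O : T) : \bar R :=
  ereal_inf [set expected_time S | S in is_search O].

Definition optimal_search (O : T) (S : R -> network) : Prop :=
  is_search O S /\
  forall S', is_search O S' -> (expected_time S <= expected_time S')%E.

Definition mean_dist (O : T) : R :=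
  \sum_(v : T) equiprob v * dist (node O) (node v).

Definition closeness (x : T) : R :=
  ((\sum_(y : T | y != x) dist (node x) (node y)) / (#|T|.-1)%:R)^-1.

End Network.

(* Main.v *)
Require Import Defs.
From mathcomp Require Import all_boot all_order all_algebra.
From mathcomp Require Import all_classical all_reals all_analysis.
From mathcomp Require Import zify lra.

(** Write d for the path distance of the tree and n for its number of nodes.

    Lower bound. A walk from O along the arcs that ends at v and visits m
    nodes has at least 2(m - 1) - d(O,v) steps ([walk_cover]): closing it up
    through the path from v back to O gives a closed walk in a tree, which
    crosses each arc of the subtree that it spans at least twice. A search
    that is at the nodes u at the times tau u shadows such walks: joining by
    paths of the tree the nodes u with tau u <= tau v, in the order of the
    times tau, gives a walk to v of length at most tau v ([search_walk]).
    Hence tau v + d(O,v) >= 2 (m_v - 1), where m_v counts those u, and summing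
    over v, with sum_v m_v >= n(n + 1)/2, gives
    sum_v tau v >= n(n - 1) - sum_v d(O,v) ([hitting_sum_ge]). As tau is any
    choice of hitting times, the bound passes to the infima.

    Upper bound. In a depth-first walk every arc met so far has been crossed
    twice, except those of the path from O to the current node, which have
    been crossed once; so the k-th new node v (counting from k = 0) is met
    after exactly 2k - d(O,v) steps, and the sum of the meeting times is
    n(n - 1) - sum_v d(O,v) ([dfs_exists]). Moving along this walk at unit
    speed is a search ([traversal_search]).

    Best depot. By the value formula, minimizing the value of a depot means
    maximizing D(x) = sum_v d(x,v), and a smaller closeness is the same as a
    larger D. If x has two neighbours y and z, then
    d(y,v) + d(z,v) >= 2 d(x,v) for all v, strictly for v = x, since at most
    one of y and z is on the path from x to v ([gdist_convex]); so
    D(y) + D(z) > 2 D(x) and x does not maximize D. The maximizers of D over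
    all nodes are therefore leaves ([argmax_leaf]), so they are exactly its
    maximizers over the leaves. *)

Set Implicit Arguments.
Unset Strict Implicit.
Unset Printing Implicit Defensive.
Import Order.TTheory GRing.Theory Num.Theory.
Local Open Scope classical_set_scope.
Local Open Scope ring_scope.

(** * Distance in a tree *)

Section TreePaths.
Variables (T : finType) (adj : rel T).
Implicit Types (u v x y z : T) (p q s : seq T).
Local Open Scope nat_scope.

Definition simple_path u v p :=
  [&& path adj u p, uniq (u :: p) & last u p == v].

Definition geodesic u v := xget [::] [set p | simple_path u v p].

Definition gdist u v := size (geodesic u v).

Lemma walk_simple u s : path adj u s ->
  exists p, [/\ simple_path u (last u s) p, {subset p <= s} & size p <= size s].
Proof.
move=> /shortenP[p pp up sub]; exists p; split.
- by rewrite /simple_path pp up eqxx.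
- exact: sub.
- by apply: uniq_leq_size sub; case/andP: up.
Qed.

Hypothesis treeQ : is_tree adj.

Lemma adj_sym : symmetric adj. Proof. by case: treeQ. Qed.
Lemma adj_irr : irreflexive adj. Proof. by case: treeQ. Qed.

Lemma simple_loop u p : simple_path u u p -> p = [::].
Proof.
case: p => [//|a p] /and3P[_ /= /andP[/negP up _] /eqP lp].
by case: up; rewrite -{1}lp mem_last.
Qed.

(** Two simple paths with the same ends that leave u through different
    neighbours a and b would join a to b without meeting u; together with the
    arcs ua and bu this closes into a cycle. *)
Lemma simple_path_unique u v p q :
  simple_path u v p -> simple_path u v q -> p = q.
Proof.
elim: p u q => [|a p IH] u [|b q] //.
- by move=> /and3P[_ _ /eqP <-] /simple_loop.
- by move=> + /and3P[_ _ /eqP E]; rewrite -E => /simple_loop.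
move=> /and3P[/= /andP[ua pa] /andP[nu up] /eqP lp].
move=> /and3P[/= /andP[ub pb] /andP[nu' uq] /eqP lq].
have [ab|ab] := eqVneq a b.
  subst b; congr (_ :: _).
  by apply: (IH a); rewrite /simple_path /= ?pa ?pb ?up ?uq ?lp ?lq ?eqxx.
exfalso.
(* from a along p to the common end, then back along q to b *)
set w := p ++ rev (belast b q).
have pw : path adj a w.
  rewrite /w cat_path pa /= lp -lq rev_path.
  by rewrite (eq_path (e' := adj)) // => x y; rewrite /= adj_sym.
have lw : last a w = b.
  rewrite /w last_cat lp -lq.
  by case: (q) => [//|c q' /=]; rewrite rev_cons last_rcons.
have uw : u \notin a :: w.
  rewrite /w -cat_cons mem_cat negb_or nu mem_rev.
  by apply: contra nu' => /mem_belast.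
have [r [/and3P[pr ur /eqP lr] sub _]] := walk_simple pw.
case: treeQ => _ _ _ /(_ (u :: a :: r)); apply.
  by case: r lr {pr ur sub} => [|//]; rewrite lw /= => /eqP; rewrite (negPf ab).
rewrite /ucycle cons_uniq ur andbT /= rcons_path ua pr lr lw /= adj_sym ub /=.
by move: uw; rewrite !in_cons !negb_or => /andP[-> uw] /=; apply: contra uw => /sub.
Qed.

Lemma geodesicP u v : simple_path u v (geodesic u v).
Proof.
have /connectP[s /walk_simple[p [sp _ _]] E] : connect adj u v by case: treeQ.
apply: (xgetPex [::] (P := [set p | simple_path u v p])).
by exists p; rewrite /= E.
Qed.

Lemma gdistE u v p : simple_path u v p -> gdist u v = size p.
Proof. by move=> /(simple_path_unique (geodesicP u v)) <-. Qed.

Lemma gdist0 u : gdist u u = 0.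
Proof. by rewrite (@gdistE _ _ [::]) // /simple_path /= eqxx. Qed.

Lemma gdist_le_walk u s : path adj u s -> gdist u (last u s) <= size s.
Proof. by move=> /walk_simple[p [/gdistE -> _]]. Qed.

Lemma gdist_eq0 u v : (gdist u v == 0) = (u == v).
Proof.
have /and3P[_ _ /eqP lp] := geodesicP u v.
by apply/idP/eqP => [/nilP E|->]; [rewrite -lp E|rewrite gdist0].
Qed.

Lemma gdist_rcons u v a : adj v a -> gdist u a <= (gdist u v).+1.
Proof.
move=> va; have /and3P[pp _ /eqP lp] := geodesicP u v.
have := @gdist_le_walk u (rcons (geodesic u v) a).
by rewrite rcons_path pp lp va last_rcons size_rcons; apply.
Qed.

(** A new node is always met while moving away from the start: the shortened
    walk followed by v is still simple, hence is the path to v. *)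
Lemma gdist_fresh u s v : path adj u s -> adj (last u s) v ->
  v \notin u :: s -> gdist u v = (gdist u (last u s)).+1.
Proof.
move=> ps sv vs; have [p [sp sub _]] := walk_simple ps.
rewrite (gdistE sp) -(size_rcons p v); apply: gdistE.
have /and3P[pp up /eqP lp] := sp.
rewrite /simple_path rcons_path pp lp sv last_rcons eqxx andbT -rcons_cons rcons_uniq up andbT.
by move: vs; rewrite !in_cons !negb_or => /andP[-> vs]; rewrite /= andbT; apply: contra vs => /sub.
Qed.

Lemma card_rcons_walk u s v :
  #|rcons (u :: s) v| = (v \notin u :: s) + #|u :: s|.
Proof.
have -> : #|rcons (u :: s) v| = #|[predU1 v & u :: s]|.
  by apply: eq_card => x; rewrite mem_rcons !inE.
by rewrite cardU1.
Qed.

(** The quantity size s + d(u, end) grows by exactly 2 on a step to a new node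
    ([gdist_fresh]) and never decreases on the other steps. *)
Lemma walk_cover u s : path adj u s ->
  2 * #|u :: s| <= size s + gdist u (last u s) + 2.
Proof.
elim/last_ind: s => [|s v IH]; first by rewrite gdist0 (card_uniqP (isT : uniq [:: _])).
rewrite rcons_path => /andP[ps sv]; have {}IH := IH ps.
rewrite size_rcons last_rcons -rcons_cons card_rcons_walk.
have [vs|vs] := boolP (v \in u :: s); last first.
  rewrite (gdist_fresh ps sv vs) /=.
  by move: IH; move: #|_| (gdist _ _) => c g; lia.
have := gdist_rcons u (a := last u s) (v := v); rewrite adj_sym => /(_ sv).
by rewrite add0n; move: IH; move: #|_| (gdist _ _) (gdist _ (last _ _)) => c g g'; lia.
Qed.

(** State of a depth-first walk O :: s with stack p, the path from O to the
    current node. Only nodes on the stack may have unvisited neighbours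
    ([dfs_closed]). In [dfs_sum], the index of v in O :: s is the time of its
    first visit, and the right-hand side is the sum of 2k over the ranks k of
    the nodes visited so far. *)
Record dfs_state O s p : Prop := DfsState {
  dfs_walk : path adj O s;
  dfs_stack : simple_path O (last O s) p;
  dfs_stack_sub : {subset p <= O :: s};
  dfs_closed : forall x y, x \in O :: s -> adj x y -> y \notin O :: s ->
    x \in O :: p;
  dfs_size : size s + size p + 2 = 2 * #|O :: s|;
  dfs_sum : \sum_(v in O :: s) (index v (O :: s) + gdist O v)
    = #|O :: s| * #|O :: s|.-1
}.

(** The new node gets rank m = #|O :: s| and is met at time
    2m - d(O,v), which adds 2m to [dfs_sum]. *)
Lemma dfs_push O s p v : dfs_state O s p -> adj (last O s) v ->
  v \notin O :: s -> dfs_state O (rcons s v) (rcons p v).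
Proof.
case=> ps sp sub fin sz sm sv vs.
have /and3P[pp up /eqP lp] := sp.
have vp : v \notin O :: p.
  move: (vs); rewrite !in_cons !negb_or => /andP[-> _] /=.
  by apply: contra vs => /sub.
have card : #|O :: rcons s v| = #|O :: s|.+1.
  by rewrite -rcons_cons card_rcons_walk vs.
have mem x : (x \in O :: rcons s v) = (x == v) || (x \in O :: s).
  by rewrite -rcons_cons mem_rcons inE.
split.
- by rewrite rcons_path ps.
- rewrite /simple_path rcons_path pp lp sv !last_rcons eqxx andbT.
  by rewrite -rcons_cons rcons_uniq vp up.
- by move=> x; rewrite mem mem_rcons inE => /orP[->//|/sub ->]; rewrite orbT.
- move=> x y; rewrite !mem negb_or -rcons_cons mem_rcons inE.
  by move=> /orP[->//|xs] xy /andP[_ ys]; rewrite (fin x y) ?orbT.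
- by rewrite card !size_rcons; lia.
- rewrite card (bigD1 v); last by rewrite mem eqxx.
  have -> : \sum_(i in O :: rcons s v | i != v)
      (index i (O :: rcons s v) + gdist O i) = #|O :: s| * #|O :: s|.-1.
    rewrite -sm; apply: eq_big => [x|x].
      by rewrite mem; have [->|] := eqVneq x v; rewrite ?(negPf vs) //= ?andbT.
    rewrite mem => /andP[/orP[->//|xs] _].
    by rewrite -rcons_cons -cats1 index_cat xs.
  rewrite -rcons_cons -[X in index _ X]cats1 index_cat (negPf vs) [index v [:: v]]/= eqxx addn0.
  rewrite (gdist_fresh ps sv vs) -lp (@gdistE O (last O p) p) ?lp //=.
  by move: sz; case: #|_| => [|c]; rewrite /= ?mulSn; nia.
Qed.

(** Backtracking keeps [dfs_closed], as v leaves the stack only when all its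
    neighbours are visited. *)
Lemma dfs_pop O s p v : dfs_state O s (rcons p v) ->
  (forall y, adj (last O s) y -> y \in O :: s) ->
  dfs_state O (rcons s (last O p)) p.
Proof.
case=> ps sp sub fin sz sm full.
have /and3P[] := sp; rewrite rcons_path => /andP[pp pv].
rewrite -rcons_cons rcons_uniq last_rcons => /andP[vp up] /eqP lp.
have lps : last O p \in O :: s.
  have := mem_last O p; rewrite in_cons => /orP[/eqP->|lp']; first by rewrite mem_head.
  by apply: sub; rewrite mem_rcons inE lp' orbT.
have mem x : (x \in O :: rcons s (last O p)) = (x \in O :: s).
  by rewrite -rcons_cons mem_rcons inE; case: eqVneq => // ->.
have card : #|O :: rcons s (last O p)| = #|O :: s| by exact: eq_card.
split.
- by rewrite rcons_path ps -lp adj_sym.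
- by rewrite /simple_path pp up last_rcons eqxx.
- by move=> x xp; rewrite mem; apply: sub; rewrite mem_rcons inE xp orbT.
- move=> x y; rewrite !mem => xs xy ys.
  have := fin x y xs xy ys; rewrite -rcons_cons mem_rcons inE => /orP[/eqP xv|//].
  by move: ys; rewrite full // -lp -xv.
- by move: sz; rewrite card !size_rcons; lia.
- rewrite card -sm; apply: eq_big => [x|x]; first exact: mem.
  by rewrite mem => xs; rewrite -rcons_cons -cats1 index_cat xs.
Qed.

Lemma dfs_done O s : dfs_state O s [::] ->
  (forall y, adj (last O s) y -> y \in O :: s) -> forall v, v \in O :: s.
Proof.
case=> ps /and3P[_ _ /= /eqP lO] _ fin _ _ full v.
have /connectP[q] : connect adj O v by case: treeQ.
elim/last_ind: q v => [|q y IH] v /=; first by move=> _ ->; rewrite mem_head.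
rewrite rcons_path last_rcons => /andP[pq qy] ->.
have := IH _ pq erefl => qs; apply: contraT => ys.
have := fin _ _ qs qy ys; rewrite inE => /eqP qO.
by move: ys; rewrite full // -lO -qO.
Qed.

(** By [dfs_size] the walk has fewer than 2n steps, so pushing or popping
    cannot go on for ever; the walk stops with an empty stack, that is at O. *)
Lemma dfs_exists O : exists s, [/\ path adj O s, last O s = O,
  (forall v, v \in O :: s) &
  \sum_v (index v (O :: s) + gdist O v) = #|T| * #|T|.-1].
Proof.
suff loop k s p : 2 * #|T| - size s <= k -> dfs_state O s p ->
    exists s, [/\ path adj O s, last O s = O, (forall v, v \in O :: s) &
    \sum_v (index v (O :: s) + gdist O v) = #|T| * #|T|.-1].
  apply: (loop _ [::] [::] (leqnn _)).
  split=> //.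
  - by rewrite /simple_path /= eqxx.
  - by rewrite (card_uniqP (isT : uniq [:: O])).
  - rewrite (big_pred1 O) => [|x]; last by rewrite !inE.
    by rewrite /= eqxx gdist0 (card_uniqP (isT : uniq [:: _])).
elim: k s p => [|k IH] s p meas st; have cs : #|O :: s| <= #|T| := max_card _.
  by case: st => _ _ _ _ sz _; exfalso; move: sz meas cs; move: #|O :: s| #|T| => c n; lia.
have [/existsP[v /andP[sv vs]]|/existsPn full] :=
  boolP [exists v, adj (last O s) v && (v \notin O :: s)].
  apply: IH (dfs_push st sv vs); rewrite size_rcons; move: meas; lia.
have {}full y : adj (last O s) y -> y \in O :: s.
  by move=> sy; have := full y; rewrite sy /= negbK.
case/lastP: p st => [|p v] st; last first.
  apply: IH (dfs_pop st full); rewrite size_rcons; move: meas; lia.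
have all := dfs_done st full.
have cT : #|O :: s| = #|T| by apply: eq_card => x; rewrite all.
case: st => ps /and3P[_ _ /= /eqP lO] _ _ _ sm; exists s; split=> //.
by rewrite -cT -sm; apply: eq_bigl => x; rewrite all.
Qed.

(** If the path from x to v does not start with the arc xy, then y is not on
    it at all, and prefixing y gives the path from y to v. *)
Lemma gdist_step x y v : adj x y -> head x (geodesic x v) != y ->
  gdist y v = (gdist x v).+1.
Proof.
move=> xy hy; have /and3P[pp up /eqP lp] := geodesicP x v.
apply: (@gdistE _ _ (x :: geodesic x v)).
rewrite /simple_path /= adj_sym xy pp lp eqxx andbT /= in_cons negb_or.
have yx : y != x by apply: contraTneq xy => ->; rewrite adj_irr.
rewrite yx -[_ && uniq _]/(uniq (x :: geodesic x v)) up andbT /=.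
rewrite andbT; apply/negP => yp.
move: pp up hy yp {lp}; move: (geodesic x v) => g pp up hy yp.
case/splitPr: yp pp up hy => p1 p2.
rewrite -cat_rcons cat_path -cat_cons cat_uniq => /andP[p1p _] /andP[u1 _] hy.
have /simple_path_unique E : simple_path x y [:: y].
  by rewrite /simple_path /= xy inE eq_sym yx eqxx.
have {}/E E : simple_path x y (rcons p1 y).
  by rewrite /simple_path p1p u1 last_rcons eqxx.
by move: hy; rewrite -E /= eqxx.
Qed.

(** At most one of y and z is the first node on the path from x to v; the
    other one is farther from v than x, and no neighbour is nearer by more
    than 1. *)
Lemma gdist_convex x y z v : adj x y -> adj x z -> y != z ->
  gdist x v + gdist x v + (v == x) <= gdist y v + gdist z v.
Proof.
move=> xy xz yz.
have lip a : adj x a -> gdist x v <= (gdist a v).+1.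
  move=> xa; have /and3P[pp up /eqP lp] := geodesicP a v.
  by have := @gdist_le_walk x (a :: geodesic a v); rewrite /= xa pp lp; apply.
have [vx|vx] := eqVneq v x.
  have nx a : adj x a -> 0 < gdist a v.
    by move=> xa; rewrite lt0n gdist_eq0 vx; apply: contraTneq xa => ->; rewrite adj_irr.
  have := nx y xy; have := nx z xz; rewrite vx gdist0; lia.
have := lip y xy; have := lip z xz.
have [h|h] := eqVneq (head x (geodesic x v)) y; last by rewrite (gdist_step xy h) //; lia.
by rewrite (@gdist_step x z v) ?h //; lia.
Qed.

(** Summing [gdist_convex] over v, two distinct neighbours of x would have
    distance sums with a mean above that of x. *)
Lemma argmax_leaf x : 2 <= #|T| ->
  (forall y, \sum_v gdist y v <= \sum_v gdist x v) -> is_leaf adj x.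
Proof.
move=> n2 max; rewrite /is_leaf eqn_leq; apply/andP; split.
  rewrite leqNgt; apply/negP => /card_gt1P[y [z []]].
  rewrite !inE => xy xz yz.
  have : \sum_v (gdist x v + gdist x v + (v == x)) <= \sum_v (gdist y v + gdist z v).
    by apply: leq_sum => v _; apply: gdist_convex.
  rewrite !big_split /= [X in _ + X <= _](bigD1 x) //= eqxx.
  by have := max y; have := max z; lia.
have /card_gt1P[a [b [_ _ ab]]] : 1 < #|predT : pred T| by [].
have [y yx] : exists y, y != x.
  by have [E|] := eqVneq a x; [exists b; rewrite -E eq_sym|exists a].
have /and3P[pp _ /eqP lp] := geodesicP x y.
case: (geodesic x y) pp lp => [|z p] /=; first by move=> _ E; rewrite E eqxx in yx.
by move=> /andP[xz _] _; apply/card_gt0P; exists z; rewrite inE.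
Qed.

End TreePaths.

(** * The metric of the network at its nodes *)

Local Notation coord := Defs.coord.

Section NetworkMetric.
Variables (R : realType) (T : finType) (adj : rel T).
Implicit Types (u v x y z : T) (p q : network R adj).

Lemma coord_ge0 p u : 0 <= coord p u.
Proof. by case: p => p /= /and3P[/forallP + _ _]; apply. Qed.

Lemma coord_le1 p u : coord p u <= 1.
Proof.
have E : \sum_v coord p v = 1 by case: p => p /= /and3P[_ /eqP].
by rewrite -E (bigD1 u) //= lerDl sumr_ge0 // => v _; apply: coord_ge0.
Qed.

Lemma route_length_ge0 p q l : route_length p q l -> 0 <= l.
Proof.
case=> [[u [v [_ _ _ ->]]]|[u [s [_ _ _ ->]]]]; first exact: normr_ge0.
by rewrite addr_ge0 ?subr_ge0 ?coord_le1 // addr_ge0 ?subr_ge0 ?coord_le1 ?ler0n. 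
Qed.

Lemma dist_le p q l : route_length p q l -> dist p q <= l.
Proof.
by move=> pql; apply: ge_inf => //; exists 0 => x; apply: route_length_ge0.
Qed.

Lemma coord_node u v : coord (node R adj u) v = (v == u)%:R.
Proof. by rewrite /coord /= ffunE. Qed.

Lemma node_inj : injective (node R adj).
Proof.
move=> u v E; have := coord_node u u; rewrite E coord_node eqxx.
by case: eqVneq => // _ /eqP; rewrite eq_sym oner_eq0.
Qed.

Hypothesis treeQ : is_tree adj.

(** A route between two nodes is a walk of the tree or a single arc, so the
    network metric restricts to the path distance. *)
Lemma dist_node u v : dist (node R adj u) (node R adj v) = (gdist adj u v)%:R.
Proof.
have /and3P[pp _ /eqP lp] := geodesicP treeQ u v.
apply/eqP; rewrite eq_le; apply/andP; split.
  apply: dist_le; right; exists u, (geodesic adj u v); split=> //.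
  - by rewrite coord_node eqxx.
  - by rewrite lp coord_node eqxx.
  - by rewrite lp !coord_node !eqxx subrr add0r addr0.
apply: lb_le_inf.
  exists (1 - coord (node R adj u) u + (gdist adj u v)%:R
  + (1 - coord (node R adj v) v)).
  by right; exists u, (geodesic adj u v); rewrite pp lp !coord_node !eqxx; split.
move=> l [[a [b [ab /forallP sa /forallP sb ->]]]|[a [s [ua ps sv ->]]]].
  have [->|uv] := eqVneq u v; first by rewrite gdist0 ?normr_ge0.
  have walk1 x y : adj x y -> (gdist adj x y <= 1)%N.
    by move=> xy; apply: (@gdist_le_walk _ _ treeQ x [:: y]); rewrite /= xy.
  have [[Ea Eb]|[Ea Eb]] : (u = a /\ v = b) \/ (u = b /\ v = a).
    move: (sa u) (sb v) uv; rewrite !coord_node !eqxx oner_neq0 /=.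
    by do 2![case/orP => /eqP->]; rewrite ?eqxx //; [left|right].
  - rewrite !coord_node Ea eqxx -Ea (negPf uv) subr0 normr1 lern1 Ea Eb.
    exact: walk1.
  - rewrite !coord_node Eb eqxx -Eb eq_sym (negPf uv) sub0r normrN1 lern1 Ea Eb.
    by apply: walk1; rewrite (adj_sym treeQ).
move: ua sv; rewrite !coord_node.
case: (eqVneq a u) ps => [->|]; last by rewrite ltxx.
case: (eqVneq (last u s) v) => [E ps _ _|]; last by rewrite ltxx.
by rewrite !subrr add0r addr0 ler_nat -E; apply: gdist_le_walk.
Qed.

End NetworkMetric.

(** * Lower bound for every search *)

Section SearchLowerBound.
Variables (R : realType) (T : finType) (adj : rel T).
Hypothesis treeQ : is_tree adj.
Variables (O : T) (S : R -> network R adj).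
Hypothesis searchS : is_search O S.
Implicit Types (u v : T) (ns : seq T).

Lemma search_gdist t1 t2 u v : 0 <= t1 -> t1 <= t2 ->
  S t1 = node R adj u -> S t2 = node R adj v -> (gdist adj u v)%:R <= t2 - t1.
Proof.
move=> t1_ge0; rewrite le_eqVlt => /orP[/eqP -> -> /node_inj ->|t12 Eu Ev].
  by rewrite gdist0 ?subrr.
by rewrite -(dist_node R treeQ) -Eu -Ev; apply: searchS.2.
Qed.

Variable tau : T -> R.
Hypothesis tau_ge0 : forall v, 0 <= tau v.
Hypothesis tau_hit : forall v, S (tau v) = node R adj v.

(** The search needs at least d(u,v) between two consecutive hits, so the
    paths of the tree through the listed nodes are no longer than the search. *)
Lemma search_walk u ns : path (relpre tau <=%R) u ns ->
  exists s, [/\ path adj u s, last u s = last u ns, {subset ns <= u :: s} &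
    (size s)%:R <= tau (last u ns) - tau u].
Proof.
elim: ns u => [|v ns IH] u /=; first by exists [::]; rewrite subrr.
move=> /andP[uv /IH[s [ps ls sub sz]]].
have /and3P[pg _ /eqP lg] := geodesicP treeQ u v.
exists (geodesic adj u v ++ s); split.
- by rewrite cat_path pg lg.
- by rewrite last_cat lg.
- have vg : v \in u :: geodesic adj u v by rewrite -{1}lg mem_last.
  move=> x; rewrite inE => /orP[/eqP->|/sub].
    by rewrite -cat_cons mem_cat vg.
  rewrite inE => /orP[/eqP->|xs]; first by rewrite -cat_cons mem_cat vg.
  by rewrite -cat_cons mem_cat xs orbT.
- rewrite size_cat natrD.
  by have := search_gdist (tau_ge0 u) uv (tau_hit u) (tau_hit v); rewrite /gdist; lra.
Qed.

Hypothesis tauO : tau O = 0.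

(** The nodes hit no later than v, in order of their hitting times, are all on
    a walk to v of length at most tau v, to which [walk_cover] applies. *)
Lemma hitting_time_ge v :
  2 * #|[pred u | tau u <= tau v]|%:R - 2 - (gdist adj O v)%:R <= tau v.
Proof.
(* v is listed again at the end of the walk to make it end at v, whatever
   the order of possible ties *)
pose ns := sort (relpre tau <=%R) [seq u <- enum T | tau u <= tau v].
have mem_ns u : (u \in ns) = (tau u <= tau v).
  by rewrite mem_sort mem_filter mem_enum andbT.
have pns : path (relpre tau <=%R) O (rcons ns v).
  rewrite rcons_path path_min_sorted; last first.
    by apply/allP => u _ /=; rewrite tauO.
  rewrite sort_sorted; last by move=> x y; apply: le_total.
  have := mem_last O ns; rewrite inE => /orP[/eqP->|] /=; first by rewrite tauO.
  by rewrite mem_ns.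
have [s [ps ls sub sz]] := search_walk pns.
move: ls sz; rewrite last_rcons tauO subr0 => ls sz.
have := walk_cover treeQ ps; rewrite ls => cov.
have sub' : (#|[pred u | (tau u <= tau v)%R]| <= #|O :: s|)%N.
  apply: subset_leq_card; apply/fintype.subsetP => u; rewrite inE => uv.
  by apply: sub; rewrite mem_rcons inE mem_ns uv orbT.
have : (2 * #|[pred u | (tau u <= tau v)%R]| <= size s + gdist adj O v + 2)%N.
  by apply: leq_trans cov; rewrite leq_mul2l.
by rewrite -(ler_nat R) natrM !natrD; lra.
Qed.

(** Of any two nodes at least one is hit no later than the other, which
    counts each unordered pair once and each node once. *)
Lemma sum_card_before :
  (#|T| * #|T| + #|T| <= 2 * \sum_v #|[pred u | (tau u <= tau v)%R]|)%N.
Proof.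
have -> : (\sum_v #|[pred u | (tau u <= tau v)%R]| =
    \sum_v \sum_u (tau u <= tau v)%R)%N.
  by apply: eq_bigr => v _; rewrite -sum1_card big_mkcond.
(* symmetrize the double sum over pairs (u, v) *)
rewrite mul2n -addnn {2}exchange_big /= -big_split /=.
under eq_bigr do rewrite -big_split /=.
apply: (@leq_trans (\sum_(v : T) \sum_(u : T) (1 + (u == v)))).
  under eq_bigr => v _ do rewrite big_split /= sum1_card -big_mkcond /= big_pred1_eq.
  by rewrite sum_nat_const mulnDr muln1.
apply: leq_sum => v _; apply: leq_sum => u _.
by case: eqVneq => [->|_]; rewrite ?lexx //; case: (lerP (tau u) (tau v)) => // /ltW ->.
Qed.

Lemma hitting_sum_ge :
  #|T|%:R * (#|T|%:R - 1) - \sum_v (gdist adj O v)%:R <= \sum_v tau v.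
Proof.
have : \sum_v (2 * #|[pred u | tau u <= tau v]|%:R - 2 - (gdist adj O v)%:R)
    <= \sum_v tau v by apply: ler_sum => v _; apply: hitting_time_ge.
rewrite !sumrB -mulr_sumr sumr_const -natr_sum.
have := sum_card_before; rewrite -(ler_nat R) natrD !natrM.
by lra.
Qed.

End SearchLowerBound.

Section ExpectedTime.
Variables (R : realType) (T : finType) (adj : rel T).
Hypothesis treeQ : is_tree adj.
Hypothesis n_ge2 : (2 <= #|T|)%N.
Implicit Types (O v : T).

Lemma sum_equiprob (f : T -> R) :
  \sum_v equiprob R v * f v = (\sum_v f v) / #|T|%:R.
Proof. by rewrite -mulr_sumr mulrC. Qed.

Lemma mean_distE O :
  mean_dist R adj O = (\sum_v gdist adj O v)%:R / #|T|%:R.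
Proof.
rewrite /mean_dist sum_equiprob natr_sum; congr (_ / _).
by apply: eq_bigr => v _; rewrite dist_node.
Qed.

Lemma first_time_ge0 (S : R -> network R adj) x : (0 <= first_time S x)%E.
Proof. by apply: le_ereal_inf_tmp => _ [t [t0 _] <-]; rewrite lee_fin. Qed.

(** If some node is never hit the expected time is infinite. Otherwise
    hitting times within e / n of each infimum satisfy [hitting_sum_ge], and e
    is arbitrary. *)
Lemma expected_time_ge O (S : R -> network R adj) : is_search O S ->
  ((#|T|%:R - 1 - mean_dist R adj O)%:E <= expected_time S)%E.
Proof.
move=> searchS; have n0 : 0 < #|T|%:R :> R by rewrite ltr0n; apply: leq_trans n_ge2.
pose hits v := [set t | 0 <= t /\ S t = node R adj v].
have [hit|/existsNP[v /nonemptyPn v0]] := pselect (forall v, hits v !=set0); last first.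
  have ft_ge0 u : (0 <= (equiprob R u)%:E * first_time S (node R adj u))%E.
    by rewrite mule_ge0 ?first_time_ge0 // lee_fin invr_ge0 ltW.
  rewrite /expected_time (bigD1 v) //= /first_time -/(hits v) v0 image_set0 ereal_inf0.
  rewrite gt0_muley ?lte_fin ?invr_gt0 // addye ?leey //.
  by rewrite gt_eqF // (@lt_le_trans _ _ 0%E) ?ltNyr // sume_ge0.
have ftE v : first_time S (node R adj v) = (inf (hits v))%:E.
  apply: ereal_inf_EFin; last exact: hit.
  by exists 0 => t [].
rewrite /expected_time; under eq_bigr do rewrite ftE -EFinM.
rewrite sumEFin lee_fin sum_equiprob mean_distE ler_pdivlMr //.
rewrite mulrBl mulrVK ?unitfE ?gt_eqF // mulrC natr_sum.
apply/ler_addgt0Pr => e e0.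
have en0 : 0 < e / #|T|%:R by rewrite divr_gt0.
have near v : exists t, hits v t /\ t < inf (hits v) + e / #|T|%:R.
  have [|t ht lt] := inf_adherent en0 (E := hits v).
    by split; [exact: hit|exists 0 => t []].
  by exists t.
(* time 0 is a hitting time of O, and [hitting_sum_ge] requires this one *)
pose tau v := if v == O then 0 else sval (cid (near v)).
have tau_hits v : hits v (tau v).
  rewrite /tau; case: eqVneq => [->|_]; last by case: (cid _) => t [].
  by split=> //; exact: searchS.1.
have := @hitting_sum_ge R T adj treeQ O S searchS tau.
move=> /(_ (fun v => (tau_hits v).1) (fun v => (tau_hits v).2)).
rewrite {1}/tau eqxx => /(_ erefl) /le_trans; apply.
have -> : \sum_v inf (hits v) + e = \sum_v (inf (hits v) + e / #|T|%:R).
  by rewrite big_split /= sumr_const -[_ *+ _]mulr_natr mulrVK ?unitfE ?gt_eqF.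
apply: ler_sum => v _; rewrite /tau; case: eqVneq => [->|_].
  apply: addr_ge0; last exact: ltW.
  apply: lb_le_inf; last by move=> t [].
  exact: hit.
by case: (cid _) => t /= -[_ /ltW].
Qed.

End ExpectedTime.

(** * Searches along a walk *)

Section Traversal.
Variables (R : realType) (T : finType) (adj : rel T).
Hypothesis adj_irr : irreflexive adj.

(** Barycentric coordinates of the point of the arc uv at distance s from u. *)
Definition arc_coord (u v : T) (s : R) : {ffun T -> R} :=
  [ffun x => (1 - s) * (x == u)%:R + s * (x == v)%:R].

Lemma arc_supported u v s : supported_on u v (arc_coord u v s).
Proof.
apply/forallP => x; apply/implyP; rewrite ffunE.
by do 2!case: (x == _) => //; rewrite !mulr0 addr0 eqxx.
Qed.

Lemma arc_on_network u v s : adj u v -> 0 <= s <= 1 ->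
  on_network adj (arc_coord u v s).
Proof.
move=> uv /andP[s0 s1]; apply/and3P; split.
- by apply/forallP => x; rewrite ffunE addr_ge0 // mulr_ge0 ?subr_ge0 ?ler0n.
- under eq_bigr do rewrite ffunE.
  rewrite big_split /= -!mulr_sumr -!natr_sum.
  have one x : (\sum_i (i == x) = 1)%N by rewrite -big_mkcond /= big_pred1_eq.
  by rewrite !one !mulr1 subrK.
- apply/existsP; exists u; apply/existsP; exists v.
  by rewrite uv orbT arc_supported.
Qed.

Variable w : nat -> T.
Hypothesis w_adj : forall k, adj (w k) (w k.+1).

(** The position at time t of a point that moves along w_0, w_1, ... at unit
    speed. The default value of insubd only serves negative times. *)
Definition traversal (t : R) : network R adj :=
  let k := Num.truncn t in
  insubd (node R adj (w 0) : {p : {ffun T -> R} | on_network adj p})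
    (arc_coord (w k) (w k.+1) (t - k%:R)).

Lemma coord_traversal t : 0 <= t -> let k := Num.truncn t in
  coord (traversal t) = arc_coord (w k) (w k.+1) (t - k%:R).
Proof.
move=> t0 k; have /andP[kt tk] := truncn_itv t0.
rewrite /coord /traversal; apply: insubdK; apply: arc_on_network => //.
by rewrite subr_ge0 kt lerBlDr addrC natr1 ltW.
Qed.

Lemma traversal_nat k : traversal k%:R = node R adj (w k).
Proof.
apply: val_inj; rewrite /= -[LHS]/(coord _) coord_traversal // natrK subrr.
by apply/ffunP => x; rewrite !ffunE mul0r addr0 subr0 mul1r.
Qed.

Lemma path_walk i m : path adj (w i) [seq w j | j <- iota i.+1 m].
Proof. by elim: m i => //= m IH i; rewrite w_adj IH. Qed.

Lemma last_walk i m : last (w i) [seq w j | j <- iota i.+1 m] = w (i + m)%N.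
Proof. by elim: m i => [|m IH] i /=; rewrite ?addn0 // IH addSnnS. Qed.

(** Between different arcs the route leaves the first point along its arc in
    the direction of motion and follows the walk. *)
Lemma dist_traversal t1 t2 : 0 <= t1 -> t1 < t2 ->
  dist (traversal t1) (traversal t2) <= t2 - t1.
Proof.
move=> t1_ge0 t12; have t2_ge0 := le_trans t1_ge0 (ltW t12).
have c1 := coord_traversal t1_ge0; have c2 := coord_traversal t2_ge0.
have /andP[kt1 tk1] := truncn_itv t1_ge0.
have /andP[kt2 tk2] := truncn_itv t2_ge0.
have k12 : (Num.truncn t1 <= Num.truncn t2)%N by apply: le_truncn; apply: ltW.
move: (Num.truncn t1) (Num.truncn t2) => k1 k2 in c1 c2 kt1 tk1 kt2 tk2 k12 *.
have wS k : (w k == w k.+1) = false.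
  by apply: contraTF (w_adj k) => /eqP <-; rewrite adj_irr.
have arc_l k s : arc_coord (w k) (w k.+1) s (w k) = 1 - s.
  by rewrite ffunE eqxx wS mulr1 mulr0 addr0.
have arc_r k s : arc_coord (w k) (w k.+1) s (w k.+1) = s.
  by rewrite ffunE eqxx eq_sym wS mulr1 mulr0 add0r.
apply: dist_le; move: k12; rewrite leq_eqVlt => /orP[/eqP k12|k12].
  rewrite -k12 in c2 kt2 tk2.
  left; exists (w k1), (w k1.+1); rewrite c1 c2; split; rewrite ?arc_supported //.
  by rewrite !arc_l ger0_norm; lra.
have [m k2E] : exists m, k2 = (k1 + m).+1 by exists (k2 - k1.+1)%N; lia.
have k2R : k2%:R = k1%:R + m%:R + 1 :> R by rewrite k2E -natr1 natrD.
right; have [t1k|kt1'] := leP t1 k1%:R.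
  (* a node has a zero coordinate at the next node, so the route has to start
     at the node itself *)
  exists (w k1), [seq w j | j <- iota k1.+1 m.+1].
  rewrite c1 c2 path_walk last_walk addnS -k2E !arc_l size_map size_iota -natr1.
  move: k2R tk2; rewrite -natr1 => k2R tk2.
  by split=> //; lra.
exists (w k1.+1), [seq w j | j <- iota k1.+2 m].
rewrite c1 c2 path_walk last_walk addSn -k2E arc_r arc_l size_map size_iota.
move: k2R tk2; rewrite -natr1 => k2R tk2.
by split=> //; lra.
Qed.

Lemma traversal_search : is_search (w 0) traversal.
Proof. by split; [exact: (traversal_nat 0)|exact: dist_traversal]. Qed.

Lemma first_time_traversal k :
  (first_time traversal (node R adj (w k)) <= (k%:R : R)%:E)%E.
Proof.
by apply: ereal_inf_lbound; exists k%:R => //; split; [exact: ler0n|exact: traversal_nat].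
Qed.

End Traversal.

(** Repeating a closed walk for ever gives a motion defined for all times. *)
Lemma closed_walk_extend (T : eqType) (adj : rel T) (O : T) (s : seq T) :
  path adj O s -> last O s = O -> (0 < size s)%N ->
  exists w : nat -> T, [/\ forall k, adj (w k) (w k.+1), w 0%N = O &
    forall k, (k <= size s)%N -> w k = nth O (O :: s) k].
Proof.
move=> ps ls s0; pose w k := nth O (O :: s) (k %% size s).
have wE k : (k <= size s)%N -> w k = nth O (O :: s) k.
  rewrite leq_eqVlt => /orP[/eqP ->|ks]; last by rewrite /w modn_small.
  by rewrite /w modnn -[X in _ = nth _ _ X]/((size (O :: s)).-1) nth_last /= ls.
exists w; split=> // [k|]; last by rewrite wE.
have km : (k %% size s < size s)%N by rewrite ltn_mod.
have -> : w k.+1 = nth O (O :: s) (k %% size s).+1.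
  by rewrite -wE // /w -addn1 -modnDml addn1.
by move/(pathP O): ps; apply.
Qed.

(** * The value of a depot *)

Section TreeValue.
Variables (R : realType) (T : finType) (adj : rel T).
Hypothesis treeQ : is_tree adj.
Hypothesis n_ge2 : (2 <= #|T|)%N.
Implicit Types (O : T).

Let n_gt0 : 0 < #|T|%:R :> R.
Proof. by rewrite ltr0n; apply: leq_trans n_ge2. Qed.

(** In the motion along the depth-first walk, v is hit no later than its index
    in the walk. *)
Lemma dfs_search O : exists2 S : R -> network R adj, is_search O S &
  (expected_time S <= (#|T|%:R - 1 - mean_dist R adj O)%:E)%E.
Proof.
have [s [ps ls all sm]] := dfs_exists treeQ O.
have s_gt0 : (0 < size s)%N.
  case: s all {ps ls sm} => // all; move: n_ge2.
  rewrite (eq_card (B := pred1 O)) ?card1 // => x.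
  by have := all x; rewrite !inE.
have [w [w_adj w0 wE]] := closed_walk_extend ps ls s_gt0.
exists (@traversal R T adj w).
  by rewrite -w0; exact: (traversal_search R (adj_irr treeQ) w_adj).
have bound v : (first_time (@traversal R T adj w) (node R adj v)
    <= ((index v (O :: s))%:R : R)%:E)%E.
  have vs := all v; have iv : (index v (O :: s) <= size s)%N.
    by rewrite -ltnS; move: vs; rewrite -index_mem.
  rewrite -{1}(nth_index O vs) -wE //.
  exact: (first_time_traversal R w_adj).
apply: (@le_trans _ _ (\sum_v (equiprob R v * (index v (O :: s))%:R)%:E)%E).
  apply: lee_sum => v _; rewrite EFinM; apply: lee_wpmul2l (bound v).
  by rewrite lee_fin invr_ge0 ltW.
rewrite sumEFin lee_fin sum_equiprob (mean_distE R treeQ) ler_pdivrMr //.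
rewrite mulrBl mulrVK ?unitfE ?gt_eqF // -natr_sum.
move: sm; rewrite big_split /= => sm.
have : (\sum_v index v (O :: s) + \sum_v gdist adj O v + #|T| = #|T| * #|T|)%N.
  by rewrite sm -mulnSr prednK //; apply: leq_trans n_ge2.
move/(congr1 (fun k => k%:R : R)); rewrite !natrD natrM; lra.
Qed.

Lemma value_tree O : value R adj O = (#|T|%:R - 1 - mean_dist R adj O)%:E.
Proof.
apply/eqP; rewrite eq_le; apply/andP; split.
  have [S searchS SE] := dfs_search O; apply: le_trans SE.
  by apply: ereal_inf_lbound; exists S.
by apply: le_ereal_inf_tmp => _ [S searchS <-]; apply: expected_time_ge.
Qed.

Lemma optimal_search_exists O : exists S : R -> network R adj, optimal_search O S.
Proof.
have [S searchS SE] := dfs_search O; exists S; split=> // S' searchS'.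
by apply: le_trans SE _; apply: expected_time_ge.
Qed.

(** The value and the closeness of a node both decrease strictly with its sum
    of distances, so they order the nodes in the same way. *)
Lemma value_le x y : (value R adj x <= value R adj y)%E =
  (\sum_v gdist adj y v <= \sum_v gdist adj x v)%N.
Proof.
rewrite !value_tree lee_fin lerD2l lerN2 !(mean_distE R treeQ).
by rewrite ler_pM2r ?invr_gt0 // ler_nat.
Qed.

Lemma closeness_le x y : (closeness R adj x <= closeness R adj y) =
  (\sum_v gdist adj y v <= \sum_v gdist adj x v)%N.
Proof.
have n1_gt0 : 0 < (#|T|.-1)%:R :> R by rewrite ltr0n -subn1 subn_gt0.
have sumE z : \sum_(v | v != z) dist (node R adj z) (node R adj v)
    = (\sum_v gdist adj z v)%:R.
  rewrite [in RHS](bigD1 z) //= gdist0 // add0n natr_sum.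
  by apply: eq_bigr => v _; rewrite dist_node.
have sum_gt0 z : (0 < \sum_v gdist adj z v)%N.
  rewrite lt0n sum_nat_eq0; apply/negP => /forallP all0.
  have : #|T| == #|pred1 z|.
    by apply/eqP/eq_card => v; have := all0 v; rewrite /= gdist_eq0 // !inE eq_sym => ->.
  by rewrite card1 => /eqP n1; move: n_ge2; rewrite n1.
have pos z : 0 < (\sum_v gdist adj z v)%:R / (#|T|.-1)%:R :> R.
  by rewrite divr_gt0 // ltr0n.
rewrite /closeness !sumE lef_pV2 ?posrE ?pos //.
by rewrite ler_pM2r ?invr_gt0 // ler_nat.
Qed.

End TreeValue.

Unset Implicit Arguments.

Theorem theorem5 (R : realType) (T : finType) (adj : rel T)
    (Q_tree : is_tree adj) (n_ge2 : (2 <= #|T|)%N) :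
  (forall O : T,
     (exists S : R -> network R adj, optimal_search O S) /\
     value R adj O = (#|T|%:R - 1 - mean_dist R adj O)%:E) /\
  (forall x : T,
     (forall O : T, (value R adj x <= value R adj O)%E) <->
     (is_leaf adj x /\
      forall y : T, is_leaf adj y ->
        closeness R adj x <= closeness R adj y)).
Proof.
split=> [ O|x]; first by split; [exact: optimal_search_exists|exact: value_tree].
split=> [opt|[leaf_x close_x] O].
  have max y : (\sum_v gdist adj y v <= \sum_v gdist adj x v)%N.
    by rewrite -(value_le R).
  split; first exact: (argmax_leaf Q_tree n_ge2 max).
  by move=> y _; rewrite closeness_le.
rewrite value_le //.
(* a node with the largest sum of distances is a leaf, so x is compared with it *)
case: (@arg_maxnP _ x xpredT (fun y => \sum_v gdist adj y v)%N isT) => m _ max_m.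
have leaf_m : is_leaf adj m.
  by apply: (argmax_leaf Q_tree n_ge2) => y; apply: max_m.
by apply: leq_trans (max_m O isT) _; have := close_x m leaf_m; rewrite closeness_le.
Qed.
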